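(* Let $C$ be an (optimal) binary singly even self-dual $[58,29,10]$ code whose shadow $S$ has minimum weight at least $5$, with weight enumerators of $C$ and $S$ of the form $$W_C = 1 +(319 - 24 \beta - 2 \gamma)y^{10} + (3132 + 152 \beta + 2\gamma)y^{12} + \cdots,$$ $$W_S = \beta y^5 + \gamma y^9 + (24128 - 54 \beta - 10 \gamma )y^{13} + (1469952 + 320 \beta + 45 \gamma )y^{17} + \cdots,$$ where $\beta,\gamma$ are integers and the dots denote terms of higher degree. Then $\gamma$ is an even integer.
   Context: All codes are binary: a code of length $n$ is a subspace of $\mathbb{F}_2^n$, and $[n,k,d]$ denotes length $n$, dimension $k$, minimum weight $d$. A code $C$ is self-dual if $C=C^\perp$ with respect to the standard inner product. A self-dual code is singly even if it contains a codeword of weight $\equiv 2 \pmod 4$. For a singly even self-dual code $C$, let $C_0$ be the subcode of codewords of weight $\equiv 0 \pmod 4$; the shadow of $C$ is $S=C_0^\perp\setminus C$. The weight enumerators are $W_C=\sum_i A_i y^i$ and $W_S=\sum_i B_i y^i$, where $A_i$ and $B_i$ are the numbers of vectors of weight $i$ in $C$ and $S$, respectively. A self-dual code is optimal if it has the largest minimum weight among all self-dual codes of its length (for length $58$ this largest minimum weight is $10$). It is known that every singly even self-dual $[58,29,10]$ code with shadow of minimum weight at least $5$ has weight enumerators of the displayed form for some integers $\beta,\gamma$. *)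

(* Defs.v *)
From HB Require Import structures.
From mathcomp Require Import all_boot all_order all_algebra.

Set Implicit Arguments.
Unset Strict Implicit.
Unset Printing Implicit Defensive.

Import Order.TTheory GRing.Theory Num.Theory.
Local Open Scope ring_scope.

Section BinaryCodes.
Variable n : nat.
Implicit Types (u v : 'rV['F_2]_n) (A : {set 'rV['F_2]_n}).
Implicit Type C : {vspace 'rV['F_2]_n}.

Definition wt v : nat := #|[set i | v 0 i != 0]|.

Definition dotp u v : 'F_2 := \sum_(i < n) u 0 i * v 0 i.

(* Taken for arbitrary sets of vectors, so that the subset of codewords of
   weight divisible by 4 need not first be shown to be a subspace. *)
Definition dual A : {set 'rV['F_2]_n} :=
  [set v | [forall u in A, dotp u v == 0]].

Definition codewords C : {set 'rV['F_2]_n} := [set v in C].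

Definition self_dual C : Prop := codewords C = dual (codewords C).

Definition singly_even C : Prop :=
  exists2 c, c \in C & (wt c = 2 %[mod 4])%N.

Definition doubly_even_part C : {set 'rV['F_2]_n} :=
  [set c in C | (4 %| wt c)%N].

Definition shadow C : {set 'rV['F_2]_n} :=
  dual (doubly_even_part C) :\: codewords C.

(* The zero vector is not counted. For the shadow of a code this excludes
   nothing, as 0 belongs to the code. *)
Definition min_weight_ge A (d : nat) : Prop :=
  forall v, v \in A -> v != 0 -> (d <= wt v)%N.

Definition min_weight A (d : nat) : Prop :=
  min_weight_ge A d /\ exists v, [/\ v \in A, v != 0 & wt v = d].

Definition weight_enumerator A : {poly int} :=
  \poly_(i < n.+1) (#|[set v in A | wt v == i]|%:Z).

End BinaryCodes.

(* Main.v *)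
(* If the shadow S contains a vector s of weight 9 (otherwise gamma = 0), then
   S = s + C, and all weights in S are congruent to 1 modulo 4. The signed
   indicator f(v) = (-1)^(s.v) of S has the Fourier transform -|C| f, because C
   is its own dual and s has odd weight. So the signed weight distribution
   F_i = sum of f(v) over v in S of weight i satisfies a MacWilliams identity,
   and F_(58-i) = - F_i because C contains the all-one vector. As F_1 = 0, these
   linear equations have a one-dimensional space of solutions, on which
   F_9 = - 10 F_5. Finally gamma is congruent to F_9 modulo 2, since f takes the
   values 1 and -1 on S. *)
Require Import Defs.
From HB Require Import structures.
From mathcomp Require Import all_boot all_order all_algebra.
From mathcomp Require Import finfield zify ring lra.

Set Implicit Arguments.
Unset Strict Implicit.
Unset Printing Implicit Defensive.

Import Order.TTheory GRing.Theory Num.Theory.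
Local Open Scope ring_scope.

(** * Arithmetic and signs over ['F_2] *)

Lemma F2_cases (a : 'F_2) : a = 0 \/ a = 1.
Proof. by case: a => [[|[|//]] lta]; [left | right]; apply/val_inj. Qed.

Lemma natr_F2_eq0 (m : nat) : ((m%:R : 'F_2) == 0) = ~~ odd m.
Proof. by rewrite -(dvdn_pcharf (pchar_Fp (isT : prime 2))) dvdn2. Qed.

Lemma oppmx_F2 (m n : nat) (A : 'M['F_2]_(m, n)) : - A = A.
Proof.
by apply/matrixP => i j; rewrite mxE; case: (F2_cases (A i j)) => ->; apply/val_inj.
Qed.

Definition signF2 (a : 'F_2) : int := (-1) ^+ (a != 0).

Lemma signF2D (a b : 'F_2) : signF2 (a + b) = signF2 a * signF2 b.
Proof. by case: (F2_cases a) => ->; case: (F2_cases b) => ->. Qed.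

(** * Weights, inner products and the sign transform *)

Section BinaryVectors.
Variable n : nat.
Implicit Types (c d s u v w : 'rV['F_2]_n) (C : {vspace 'rV['F_2]_n}).

(** Kept in [nat] rather than ['F_2], so that [wtD] controls weights modulo 4. *)
Definition overlap u v : nat := \sum_(i < n) ((u 0 i != 0) && (v 0 i != 0))%R.

Lemma wt_sum v : wt v = (\sum_(i < n) ((v 0 i != 0)%R : nat))%N.
Proof.
rewrite /wt cardsE -sum1_card big_mkcond /=.
by apply: eq_bigr => i _; rewrite unfold_in /=; case: (v 0 i != 0).
Qed.

Lemma wtD u v : (wt (u + v)%R + 2 * overlap u v = wt u + wt v)%N.
Proof.
rewrite !wt_sum big_distrr -!big_split /=; apply: eq_bigr => i _.
by rewrite mxE; case: (F2_cases (u 0 i)) => ->; case: (F2_cases (v 0 i)) => ->.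
Qed.

Lemma dotpE u v : dotp u v = (overlap u v)%:R.
Proof.
rewrite /overlap natr_sum; apply: eq_bigr => i _.
by case: (F2_cases (u 0 i)) => ->; case: (F2_cases (v 0 i)) => ->; apply/val_inj.
Qed.

Lemma dotp_eq0 u v : (dotp u v == 0) = ~~ odd (overlap u v).
Proof. by rewrite dotpE natr_F2_eq0. Qed.

Lemma dotpC u v : dotp u v = dotp v u.
Proof. by apply: eq_bigr => i _; rewrite mulrC. Qed.

Lemma dotpDl u v w : dotp (u + v) w = dotp u w + dotp v w.
Proof. by rewrite -big_split; apply: eq_bigr => i _; rewrite mxE mulrDl. Qed.

Lemma dotpDr u v w : dotp w (u + v) = dotp w u + dotp w v.
Proof. by rewrite !(dotpC w) dotpDl. Qed.

Lemma dotpp v : dotp v v = (wt v)%:R.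
Proof.
rewrite dotpE wt_sum; congr _%:R; apply: eq_bigr => i _; by rewrite andbb.
Qed.

Lemma signF2_dotpp v : signF2 (dotp v v) = (-1) ^+ odd (wt v).
Proof. by rewrite dotpp /signF2 natr_F2_eq0 negbK. Qed.

Lemma dotp1 v : dotp v (const_mx 1) = dotp v v.
Proof.
apply: eq_bigr => i _; rewrite mxE mulr1.
by case: (F2_cases (v 0 i)) => ->; apply/val_inj.
Qed.

Lemma wt_le v : (wt v <= n)%N.
Proof. by rewrite -[leqRHS]card_ord max_card. Qed.

Lemma wt_compl v : (wt (v + const_mx 1)%R + wt v = n)%N.
Proof.
rewrite !wt_sum -big_split -[RHS]card_ord -sum1_card /=.
apply: eq_bigr => i _.
by rewrite !mxE; case: (F2_cases (v 0 i)) => ->.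
Qed.

Lemma prod_wt v (R : comNzRingType) (a b : R) :
  \prod_(i < n) (if v 0 i != 0 then a else b) = a ^+ wt v * b ^+ (n - wt v).
Proof.
rewrite (bigID (fun i => v 0 i != 0)) /=.
rewrite (eq_bigr (fun=> a)) => [|i ->//].
rewrite [X in _ * X](eq_bigr (fun=> b)) => [|i /negPf->//].
have wtE : wt v = #|[pred i | v 0 i != 0]| by rewrite /wt cardsE.
rewrite !prodr_const wtE; congr (_ * _ ^+ _).
have := cardC [pred i | v 0 i != 0]; rewrite card_ord => cardn.
apply: (@addnI (wt v)); rewrite /= -wtE subnKC ?wt_le // -[RHS]cardn wtE.
by congr addn; apply: eq_card.
Qed.

(** The sum factors over the coordinates: [i] contributes [1 + y] if [v 0 i] is zero and [1 - y]
    otherwise. *)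
Lemma sum_sign_dotp_wt v (y : int) :
  \sum_u signF2 (dotp v u) * y ^+ wt u
    = (1 - y) ^+ wt v * (1 + y) ^+ (n - wt v).
Proof.
pose F (i : 'I_n) (a : 'F_2) : int := signF2 (v 0 i * a) * y ^+ (a != 0).
rewrite -prod_wt.
transitivity (\prod_(i < n) \sum_(a : 'F_2) F i a); last first.
  apply: eq_bigr => i _; rewrite big_ord_recl big_ord1 /F.
  have -> : lift ord0 ord0 = 1 :> 'F_2 by apply/val_inj.
  have -> : ord0 = 0 :> 'F_2 by apply/val_inj.
  rewrite mulr0 mulr1.
  by case: (F2_cases (v 0 i)) => -> /=; rewrite /signF2 /=; ring.
rewrite bigA_distr_bigA /=.
rewrite (reindex (fun f : {ffun 'I_n -> 'F_2} => \row_i f i)) /=; last first.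
  exists (fun u : 'rV_n => [ffun i => u 0 i]) => [f _ | u _].
    by apply/ffunP => i; rewrite ffunE mxE.
  by apply/rowP => i; rewrite mxE ffunE.
apply: eq_bigr => f _; rewrite /F big_split /=; congr (_ * _).
  rewrite /dotp (big_morph _ signF2D (erefl : signF2 0 = 1)).
  by apply: eq_bigr => i _; rewrite mxE.
rewrite wt_sum -prodrXr.
by apply: eq_bigr => i _; rewrite mxE.
Qed.

(** * Self-dual codes and the signed MacWilliams identity *)

Lemma self_dualP C u :
  self_dual C -> reflect (forall c, c \in C -> dotp c u = 0) (u \in C).
Proof.
move=> sdC; have -> : (u \in C) = (u \in dual (codewords C)).
  by rewrite -sdC inE.
rewrite inE; apply: (iffP forall_inP) => dC c Cc.
  by apply/eqP/dC; rewrite inE.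
by apply/eqP/dC; rewrite inE in Cc.
Qed.

Lemma self_dual_ones C : self_dual C -> const_mx 1 \in C.
Proof.
move=> sdC; apply/(self_dualP _ sdC) => c Cc.
by rewrite dotp1; apply: (self_dualP c sdC).
Qed.

(** Orthogonality of characters: for [u] outside [C], some codeword [c0] has inner product 1 with
    [u], and translation by [c0] negates the sum. *)
Lemma sum_sign_dotp_code C u : self_dual C ->
  \sum_(c in C) signF2 (dotp c u) = #|C|%:R * (u \in C)%:R.
Proof.
move=> sdC; have [Cu|C'u] := boolP (u \in C).
  rewrite mulr1 -sumr_const; apply: eq_bigr => c Cc.
  by rewrite (self_dualP _ sdC Cu).
rewrite mulr0.
have [c0 Cc0 dc0] : exists2 c0, c0 \in C & dotp c0 u = 1.
  have /existsP[c0 /andP[Cc0 dc0]] : [exists c, (c \in C) && (dotp c u != 0)].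
    apply: contraR C'u => /existsPn nC; apply/(self_dualP _ sdC) => c Cc.
    by apply/eqP; move: (nC c); rewrite Cc negbK.
  by exists c0 => //; case: (F2_cases (dotp c0 u)) dc0 => ->.
set S := \sum_(c in C) _; suff : S = - S by lia.
rewrite {1}/S (reindex_inj (addrI c0)) /=.
rewrite (eq_bigl (mem C)) => [|c]; last by rewrite /= rpredDl.
rewrite -sumrN; apply: eq_bigr => c _.
by rewrite dotpDl dc0 signF2D mulN1r.
Qed.

(* The Fourier transform of the signed indicator [(-1)^(s.v)] of [s + C] is a
   multiple of itself. *)
Lemma fourier_signed_coset C s u : self_dual C ->
  \sum_(v | v - s \in C) signF2 (dotp s v) * signF2 (dotp v u)
    = signF2 (dotp s s) * #|C|%:R * (signF2 (dotp s u) * (u - s \in C)%:R).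
Proof.
move=> sdC; rewrite (reindex_inj (addIr s)) /=.
rewrite (eq_bigl (mem C)) => [|c]; last by rewrite addrK.
rewrite (eq_bigr (fun c =>
    signF2 (dotp s s) * signF2 (dotp s u) * signF2 (dotp c (u - s)))).
  by rewrite -mulr_sumr sum_sign_dotp_code //; ring.
move=> c _; rewrite oppmx_F2 dotpDl !dotpDr !signF2D (dotpC s c).
ring.
Qed.

Lemma macwilliams_signed_coset C s (y : int) : self_dual C ->
  \sum_(v | v - s \in C)
      signF2 (dotp s v) * ((1 - y) ^+ wt v * (1 + y) ^+ (n - wt v))
    = signF2 (dotp s s) * #|C|%:R
      * \sum_(v | v - s \in C) signF2 (dotp s v) * y ^+ wt v.
Proof.
move=> sdC.
under eq_bigr do rewrite -sum_sign_dotp_wt mulr_sumr.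
rewrite exchange_big /= mulr_sumr [RHS]big_mkcond /=.
apply: eq_bigr => u _.
under eq_bigr do rewrite mulrA.
rewrite -mulr_suml fourier_signed_coset //.
by case: (u - s \in C); rewrite ?mulr0 ?mul0r ?mulr1 ?mulrA.
Qed.

(** * The shadow as a coset of the code *)

Lemma shadow_notin C s : s \in shadow C -> s \notin C.
Proof. by rewrite !inE => /andP[]. Qed.

Lemma shadow_dotp C s c : s \in shadow C -> c \in C -> (4 %| wt c)%N ->
  dotp c s = 0.
Proof.
by rewrite !inE => /andP[_ /forall_inP dC] Cc c4; apply/eqP/dC; rewrite inE Cc.
Qed.

Lemma code_wt_even C c : self_dual C -> c \in C -> ~~ odd (wt c).
Proof.
by move=> sdC Cc; rewrite -natr_F2_eq0 -dotpp; apply/eqP; apply: (self_dualP c sdC).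
Qed.

Lemma code_wtD C c d : self_dual C -> c \in C -> d \in C ->
  (wt (c + d)%R = wt c + wt d %[mod 4])%N.
Proof.
move=> sdC Cc Cd; have := wtD c d.
have : dotp c d == 0 by apply/eqP; apply: (self_dualP d sdC).
rewrite dotp_eq0; lia.
Qed.

(** Suppose [s] is orthogonal to a codeword [c] of weight 2 modulo 4. For any other such codeword
    [d], the weight of [c + d] is divisible by 4, so [s] is orthogonal to [d] too. Then [s] lies in
    the dual of [C], which is [C]. *)
Lemma shadow_dotp_wt C s c : self_dual C -> s \in shadow C -> c \in C ->
  (dotp c s == 0) = (4 %| wt c)%N.
Proof.
move=> sdC Ss Cc; apply/eqP/idP => [dcs|]; last exact: (shadow_dotp Ss Cc).
apply: contraR (shadow_notin Ss) => c4; apply/(self_dualP _ sdC) => d Cd.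
have [d4|d4] := boolP (4 %| wt d)%N; first exact: (shadow_dotp Ss).
have /(shadow_dotp Ss) : c + d \in C by rewrite rpredD.
rewrite dotpDl dcs add0r; apply.
have := code_wtD sdC Cc Cd; have := code_wt_even sdC Cc.
have := code_wt_even sdC Cd; lia.
Qed.

(** By [shadow_dotp_wt], all shadow vectors have the same inner product with a given codeword, so
    their differences lie in the dual of [C]. *)
Lemma shadow_coset C s v : self_dual C -> s \in shadow C ->
  (v \in shadow C) = (v - s \in C).
Proof.
move=> sdC Ss; apply/idP/idP => [Sv|Cvs].
  apply/(self_dualP _ sdC) => c Cc; rewrite oppmx_F2 dotpDr.
  have := shadow_dotp_wt sdC Ss Cc; rewrite -(shadow_dotp_wt sdC Sv Cc).
  case: (F2_cases (dotp c s)) => ->; case: (F2_cases (dotp c v)) => ->;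
    by rewrite ?eqxx ?oner_eq0 // => _; apply/val_inj.
rewrite (_ : v = (v - s) + s); last by rewrite subrK.
move: Cvs; move: (v - s) => c Cc.
rewrite !inE rpredDl // (shadow_notin Ss) /=.
apply/forall_inP => d; rewrite inE => /andP[Cd d4].
by rewrite dotpDr (shadow_dotp Ss) // addr0; apply/eqP; apply: (self_dualP c sdC).
Qed.

(** Adding a codeword [c] to [s] changes the weight by [wt c - 2 * overlap c s]; the overlap is odd
    exactly when [wt c] is 2 modulo 4. *)
Lemma shadow_wt_mod4 C s v : self_dual C -> s \in shadow C -> v \in shadow C ->
  (wt v = wt s %[mod 4])%N.
Proof.
move=> sdC Ss; rewrite (shadow_coset v sdC Ss) => Cvs.
rewrite (_ : v = (v - s) + s); last by rewrite subrK.
move: Cvs; move: (v - s) => c Cc.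
have := shadow_dotp_wt sdC Ss Cc; rewrite dotp_eq0.
have := wtD c s; have := code_wt_even sdC Cc.
case: (boolP (odd _)); lia.
Qed.

(** * Weight distributions, plain and signed *)

Lemma coef_weight_enumerator (A : {set 'rV['F_2]_n}) (i : nat) :
  (weight_enumerator A)`_i = #|[set v in A | wt v == i]|%:Z.
Proof.
rewrite coef_poly; case: ltnP => // lt_ni.
suff -> : [set v in A | wt v == i] = set0 by rewrite cards0.
apply/setP => v; rewrite !inE; apply/negbTE; rewrite negb_and.
by apply/orP; right; have := wt_le v; lia.
Qed.

Definition signed_count C s (i : nat) : int :=
  \sum_(v | (v - s \in C) && (wt v == i)) signF2 (dotp s v).

(** Adding the all-one codeword preserves the coset, complements weights, and flips the sign because
    [s] has odd weight. *)
Lemma signed_count_compl C s (i : nat) : self_dual C -> odd (wt s) ->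
  (i <= n)%N -> signed_count C s (n - i) = - signed_count C s i.
Proof.
move=> sdC odds le_in; rewrite /signed_count -sumrN.
have Cones := self_dual_ones sdC.
rewrite (reindex_inj (addIr (const_mx 1))) /=; apply: eq_big => [v | v _].
  rewrite addrAC rpredDr //; congr (_ && _).
  by rewrite -(eqn_add2r (wt v)) wt_compl; have := wt_le v; lia.
by rewrite dotpDr dotp1 signF2D signF2_dotpp odds mulrN1.
Qed.

Lemma sum_signed_coset C s (k a b : nat) (g : nat -> int) : (0 < a)%N ->
  (forall v, v - s \in C -> exists2 m, (m < k)%N & wt v = (a * m + b)%N) ->
  \sum_(v | v - s \in C) signF2 (dotp s v) * g (wt v)
    = \sum_(m < k) signed_count C s (a * m + b) * g (a * m + b)%N.
Proof.
move=> a_gt0 wtC; under [RHS]eq_bigr do rewrite mulr_suml.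
rewrite (exchange_big_dep (fun v => v - s \in C)) /= => [|m v _ /andP[]//].
apply: eq_bigr => v Cv; have [m ltmk wtv] := wtC v Cv.
rewrite (big_pred1 (Ordinal ltmk)) /= ?wtv // => m'.
by rewrite Cv /= eqn_add2r eqn_pmul2l // -val_eqE eq_sym.
Qed.

(** Every summand is 1 or -1, hence odd. *)
Lemma signed_count_odd C s (i : nat) : self_dual C -> s \in shadow C ->
  odd `|signed_count C s i| = odd #|[set v in shadow C | wt v == i]|.
Proof.
move=> sdC Ss; rewrite -sum1_card (big_morph odd oddD (erefl : odd 0 = false)).
rewrite /signed_count.
rewrite (big_morph (fun z : int => odd `|z|) (id1 := false) (op1 := addb)) //.
  apply: eq_big => [v | v _]; last by rewrite /signF2 abszX exp1n.
  by rewrite inE (shadow_coset v sdC Ss).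
by move=> x y; lia.
Qed.

End BinaryVectors.

(** * Length 58 *)

Lemma coef9_shadow_terms (a b c d : int) :
  (a *: 'X^5 + b *: 'X^9 + c *: 'X^13 + d *: 'X^17)`_9 = b.
Proof. by rewrite !(coefD, coefZ, coefXn) /= !mulr0 mulr1 add0r !addr0. Qed.

(* The hypothesis is the MacWilliams identity at y, with the terms of weights i
   and 58 - i paired; five values of y already give rank 5 in 6 unknowns. *)
Lemma antisymmetric_eigen58 (f5 f9 f13 f17 f21 f25 : int) :
  (forall y : int,
     f5 * ((1 - y) ^+ 5 * (1 + y) ^+ 53 - (1 - y) ^+ 53 * (1 + y) ^+ 5
           + 2 ^+ 29 * (y ^+ 5 - y ^+ 53))
     + f9 * ((1 - y) ^+ 9 * (1 + y) ^+ 49 - (1 - y) ^+ 49 * (1 + y) ^+ 9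
             + 2 ^+ 29 * (y ^+ 9 - y ^+ 49))
     + f13 * ((1 - y) ^+ 13 * (1 + y) ^+ 45 - (1 - y) ^+ 45 * (1 + y) ^+ 13
              + 2 ^+ 29 * (y ^+ 13 - y ^+ 45))
     + f17 * ((1 - y) ^+ 17 * (1 + y) ^+ 41 - (1 - y) ^+ 41 * (1 + y) ^+ 17
              + 2 ^+ 29 * (y ^+ 17 - y ^+ 41))
     + f21 * ((1 - y) ^+ 21 * (1 + y) ^+ 37 - (1 - y) ^+ 37 * (1 + y) ^+ 21
              + 2 ^+ 29 * (y ^+ 21 - y ^+ 37))
     + f25 * ((1 - y) ^+ 25 * (1 + y) ^+ 33 - (1 - y) ^+ 33 * (1 + y) ^+ 25
              + 2 ^+ 29 * (y ^+ 25 - y ^+ 33)) = 0) ->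
  f9 = - 10 * f5.
Proof.
move=> eigen; have := eigen 2; have := eigen 4; have := eigen 5.
by have := eigen 6; have := eigen 7; clear eigen; lra.
Qed.

Lemma signed_count58 (C : {vspace 'rV['F_2]_58}) (s : 'rV['F_2]_58) :
  self_dual C -> \dim C = 29%N -> s \in shadow C -> (wt s = 1 %[mod 4])%N ->
  min_weight_ge (shadow C) 5 ->
  signed_count C s 9 = - 10 * signed_count C s 5.
Proof.
move=> sdC dimC Ss s1 minS.
have odds : odd (wt s) by lia.
have shadow_wt_ge5 (v : 'rV_58) : v \in shadow C -> (5 <= wt v)%N.
  (* [min_weight_ge] skips the zero vector, which belongs to [C] and so not to the shadow. *)
  move=> Sv; apply: minS => //; apply: contraTneq Sv => ->.
  by apply/negP => /shadow_notin; rewrite mem0v.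
(* The complement of [v] is also in the shadow and has weight at least 5, so [wt v] is at most 53;
   this leaves the 13 values 5, 9, ..., 53. *)
have wtS (v : 'rV_58) : v - s \in C ->
    exists2 m, (m < 13)%N & wt v = (4 * m + 5)%N.
  rewrite -shadow_coset // => Sv.
  have Svc : v + const_mx 1 \in shadow C.
    move: Sv; rewrite !(shadow_coset _ sdC Ss) addrAC => Cvs.
    by rewrite rpredD // self_dual_ones.
  have := wt_compl v; have := shadow_wt_ge5 _ Svc; have := shadow_wt_ge5 _ Sv.
  have := shadow_wt_mod4 sdC Ss Sv.
  by move: (wt v) (wt (v + _)) => w wc *; exists ((w - 5) %/ 4)%N; lia.
have compl i : (i <= 58)%N -> signed_count C s (58 - i) = - signed_count C s i.
  exact: signed_count_compl.
(* Weight 29 is its own complement; the other 12 weights pair up into 6 unknowns. *)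
have mid : signed_count C s 29 = 0.
  by have : signed_count C s 29 = - signed_count C s 29 := compl 29%N isT; lia.
apply: (@antisymmetric_eigen58 _ _ (signed_count C s 13) (signed_count C s 17)
  (signed_count C s 21) (signed_count C s 25)) => y.
have := macwilliams_signed_coset s y sdC.
rewrite (sum_signed_coset (fun i => (1 - y) ^+ i * (1 + y) ^+ (58 - i))
  (isT : (0 < 4)%N) wtS).
rewrite (sum_signed_coset (fun i => y ^+ i) (isT : (0 < 4)%N) wtS).
rewrite signF2_dotpp odds card_vspace card_Fp // dimC natrX.
rewrite !big_ord_recr !big_ord0 /=.
set sc := signed_count C s in compl mid *.
rewrite mid (compl 5%N isT) (compl 9%N isT) (compl 13%N isT) (compl 17%N isT).
rewrite (compl 21%N isT) (compl 25%N isT) !mulnE !addnE !subnE /= => eqy.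
(* With [1 - y] and [1 + y] opaque, [ring] need not expand their high powers. *)
move: (1 - y) (1 + y) eqy => p q /eqP; rewrite -subr_eq0 => /eqP <-.
by ring.
Qed.

Theorem theorem1 (C : {vspace 'rV['F_2]_58}) (beta gamma : int) :
  self_dual C ->
  singly_even C ->
  \dim C = 29%N ->
  min_weight (codewords C) 10 ->
  min_weight_ge (shadow C) 5 ->
  take_poly 13 (weight_enumerator (codewords C)) =
    1 + (319 - 24 * beta - 2 * gamma) *: 'X^10
      + (3132 + 152 * beta + 2 * gamma) *: 'X^12 ->
  take_poly 18 (weight_enumerator (shadow C)) =
    beta *: 'X^5 + gamma *: 'X^9
      + (24 * 10 ^+ 3 + 128 - 54 * beta - 10 * gamma) *: 'X^13
      + (1469 * 10 ^+ 3 + 952 + 320 * beta + 45 * gamma) *: 'X^17 ->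
  (2 %| gamma)%Z.
Proof.
move=> sdC _ dimC _ minS _ WS.
set S9 := [set v in shadow C | wt v == 9%N].
have <- : #|S9|%:Z = gamma.
  have := congr1 (fun p : {poly int} => p`_9) WS.
  by rewrite coef9_shadow_terms coef_take_poly coef_weight_enumerator.
have [-> | [s]] := set_0Vmem S9; first by rewrite cards0.
rewrite inE => /andP[Ss /eqP wts].
suff : ~~ odd #|S9| by lia.
have s1 : (wt s = 1 %[mod 4])%N by rewrite wts.
(* The factor -10 is even, whatever the signed count at weight 5. *)
by rewrite -(signed_count_odd 9 sdC Ss) signed_count58 //; lia.
Qed.
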